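(* There exists a positive absolute constant $K$ such that for all $q>1$, all $f\in C^{2}[0,1]$, all integers $n\ge1$ and all $x\in[0,1]$, with $g(x):=f(1-x)$, $$\left|q^{n}[n]_{1/q}\bigl(R_{n,q}(f,x)-R_{\infty,q}(f,x)\bigr)-\frac{f''(x)}{2}\,v(q,x)(1-x)\right|\le K\,v(q,x)(1-x)\,\omega\!\left(g'',[n]_{1/q}^{-1/2}\right).$$
   Context: For $q>0$ and an integer $n\ge 0$: $[n]=[n]_q=1+q+\dots+q^{n-1}$, $[0]=0$ (so $[n]_{1/q}=1+q^{-1}+\dots+q^{-(n-1)}$); $[n]!=[1][2]\cdots[n]$, $[0]!=1$; for $0\le k\le n$ let ${n\brack k}=\frac{[n]!}{[k]!\,[n-k]!}$. The Lupaş $q$-analogue of the Bernstein operator is, for $q>0$, $f\in C[0,1]$, $x\in[0,1]$, $n\ge1$, $$R_{n,q}(f,x)=\sum_{k=0}^{n} f\!\left(\tfrac{[k]}{[n]}\right) {n\brack k}\frac{q^{k(k-1)/2}x^{k}(1-x)^{n-k}}{(1-x+qx)\cdots(1-x+q^{n-1}x)}.$$ For $0<q<1$ the limit $q$-Lupaş operator is $R_{\infty,q}(f,x)=\sum_{k=0}^{\infty} f(1-q^{k})\,b_{\infty k}(q;x)$ if $x\in[0,1)$ and $R_{\infty,q}(f,1)=f(1)$, where $$b_{\infty k}(q;x)=\frac{q^{k(k-1)/2}\,(x/(1-x))^{k}}{(1-q)^{k}[k]!\prod_{j=0}^{\infty}\left(1+q^{j}\,x/(1-x)\right)}.$$ For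 $q>1$, $R_{\infty,q}(f,x)=R_{\infty,1/q}(g,1-x)$ with $g(x)=f(1-x)$. Known fact (Ostrovska): for $q>1$, $R_{n,q}(f,x)=R_{n,1/q}(g,1-x)$. Further, $v(q,x)=\frac{qx}{1-x+qx}$, and $\omega(f,t)=\sup_{|x-y|\le t}|f(x)-f(y)|$ ($x,y\in[0,1]$) is the modulus of continuity. *)

(* Defs.v *)
From HB Require Import structures.
From mathcomp Require Import all_boot all_order all_algebra.
From mathcomp Require Import all_classical all_reals all_analysis.

Set Implicit Arguments.
Unset Strict Implicit.
Unset Printing Implicit Defensive.

Import Order.TTheory GRing.Theory Num.Theory.
Import numFieldNormedType.Exports.

Local Open Scope classical_set_scope.
Local Open Scope ring_scope.

Section Definitions.
Context {R : realType}.
Implicit Types (q x t : R) (f : R -> R) (n k : nat).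

(* A function on [0, 1] is represented by some f : R -> R; none of the notions
   below, used at points of [0, 1], depends on the values of f elsewhere. *)

Definition qint q n : R := \sum_(i < n) q ^+ i.

Definition qfact q n : R := \prod_(1 <= i < n.+1) qint q i.

Definition qbinom q n k : R := qfact q n / (qfact q k * qfact q (n - k)).

Definition lupas q n f x : R :=
  \sum_(k < n.+1) f (qint q k / qint q n) *
    (qbinom q n k *
     (q ^+ (k * k.-1)./2 * x ^+ k * (1 - x) ^+ (n - k) /
      \prod_(1 <= j < n) (1 - x + q ^+ j * x))).

Definition lupas_basis_lim q k x : R :=
  q ^+ (k * k.-1)./2 * (x / (1 - x)) ^+ k /
  ((1 - q) ^+ k * qfact q k *
   limn (fun m => \prod_(0 <= j < m) (1 + q ^+ j * (x / (1 - x))))).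

(* The limit operator for 0 < q < 1. *)
Definition lupas_lim_lt1 q f x : R :=
  if x == 1 then f 1 else
  limn (fun m => \sum_(0 <= k < m) f (1 - q ^+ k) * lupas_basis_lim q k x).

(* Meaningful for q > 0 with q != 1. *)
Definition lupas_lim q f x : R :=
  if q < 1 then lupas_lim_lt1 q f x
  else lupas_lim_lt1 q^-1 (fun y => f (1 - y)) (1 - x).

Definition lupas_v q x : R := q * x / (1 - x + q * x).

Definition modulus f t : R :=
  sup [set r | exists x y, [/\ x \in `[0, 1], y \in `[0, 1],
                               `|x - y| <= t & r = `|f x - f y|]].

(* Derivatives are taken relative to [0, 1], hence one-sided at 0 and 1. *)
Definition diff_quot01 f x : set_system R :=
  (fun y => (f y - f x) / (y - x)) @ within `[0, 1] x^'.

Definition derivable01 f x : Prop := cvg (diff_quot01 f x).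

Definition deriv01 f x : R := lim (diff_quot01 f x).

Definition C2_01 f : Prop :=
  [/\ {in `[0, 1], forall x, derivable01 f x},
      {in `[0, 1], forall x, derivable01 (deriv01 f) x} &
      {within `[0, 1], continuous (deriv01 (deriv01 f))}].

End Definitions.

(* Main.v *)
(* Put p = 1/q.  The reflection R_(n,q)(f, x) = R_(n,p)(g, 1 - x) reduces
   everything to a parameter in ]0, 1[, again called q.  In the odds
   u = x / (1 - x), the difference R_m f - R_(m+1) f is a combination, with
   nonnegative weights, of the second divided differences of f at
   [j]/[m] < [j+1]/[m+1] < [j+1]/[m], each of which is half a value of f''.
   The weights are proportional to a Lupas distribution with odds q^2 u, their
   total is u / ((1 + u) (1 + q u)) * (q^m / [m] - q^(m+1) / [m+1]), and they
   concentrate around x at scale [m]^(-1/2), uniformly in q.  Comparing f'' with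
   its value at x through |f''(s) - f''(x)| <= (1 + (s - x)^2 / t^2) omega(f'', t)
   for t = [n]^(-1/2), summing over m >= n and telescoping gives the estimate. *)

Require Import Defs.
From mathcomp Require Import all_boot all_order all_algebra.
From mathcomp Require Import all_classical all_reals all_analysis.
From mathcomp Require Import ring lra.

Set Implicit Arguments.
Unset Strict Implicit.
Unset Printing Implicit Defensive.

Import Order.TTheory GRing.Theory Num.Theory.
Import numFieldNormedType.Exports.

Local Open Scope classical_set_scope.
Local Open Scope ring_scope.

(** * q-integers, q-factorials and Gaussian binomials *)

Section QIntegers.
Context {R : realType}.
Implicit Types (q u : R) (n k m : nat).

Lemma qint0 q : qint q 0 = 0. Proof. by rewrite /qint big_ord0. Qed.

Lemma qintS q n : qint q n.+1 = 1 + q * qint q n.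
Proof.
rewrite /qint big_ord_recl expr0 mulr_sumr; congr (_ + _).
by apply: eq_bigr => i _; rewrite -exprS.
Qed.

Lemma qintSr q n : qint q n.+1 = qint q n + q ^+ n.
Proof. by rewrite /qint big_ord_recr. Qed.

Lemma qint1 q : qint q 1 = 1. Proof. by rewrite qintSr qint0 add0r expr0. Qed.

Lemma qintD q m n : qint q (m + n) = qint q m + q ^+ m * qint q n.
Proof.
elim: n => [|n IH]; first by rewrite addn0 qint0 mulr0 addr0.
by rewrite addnS !qintSr IH exprD; ring.
Qed.

Lemma qint_mul1B q n : (1 - q) * qint q n = 1 - q ^+ n.
Proof.
elim: n => [|n IH]; first by rewrite qint0 expr0; ring.
by rewrite qintSr mulrDr IH exprS; ring.
Qed.

Lemma qint_ge0 q n : 0 <= q -> 0 <= qint q n.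
Proof. by move=> q0; apply: sumr_ge0 => i _; exact: exprn_ge0. Qed.

Lemma qintS_ge1 q n : 0 <= q -> 1 <= qint q n.+1.
Proof. by move=> q0; rewrite qintS lerDl mulr_ge0 // qint_ge0. Qed.

Lemma qintS_gt0 q n : 0 <= q -> 0 < qint q n.+1.
Proof. by move=> q0; rewrite (lt_le_trans ltr01) ?qintS_ge1. Qed.

Lemma ler_qint q m n : 0 <= q -> (m <= n)%N -> qint q m <= qint q n.
Proof.
move=> q0 /subnKC <-; rewrite qintD lerDl mulr_ge0 ?exprn_ge0 ?qint_ge0 //.
Qed.

Lemma qfact0 q : qfact q 0 = 1.
Proof. by rewrite /qfact big_geq. Qed.

Lemma qfactS q n : qfact q n.+1 = qfact q n * qint q n.+1.
Proof. by rewrite /qfact big_nat_recr. Qed.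

Lemma qfact_gt0 q n : 0 <= q -> 0 < qfact q n.
Proof.
move=> q0; elim: n => [|n IH]; first by rewrite qfact0.
by rewrite qfactS mulr_gt0 ?qintS_gt0.
Qed.

(* Extended by 0 to n < k, where [qbinom] is junk because of truncated
   subtraction, so that Pascal's rule holds without side conditions. *)
Definition gauss q n k : R := if (k <= n)%N then qbinom q n k else 0.

Lemma gaussE q n k : (k <= n)%N -> qbinom q n k = gauss q n k.
Proof. by rewrite /gauss => ->. Qed.

Lemma gauss0 q n : 0 <= q -> gauss q n 0 = 1.
Proof.
move=> q0; rewrite /gauss /qbinom subn0 qfact0 mul1r divff //.
by rewrite gt_eqF ?qfact_gt0.
Qed.

Lemma gauss_small q n k : (n < k)%N -> gauss q n k = 0.
Proof. by move=> nk; rewrite /gauss leqNgt nk. Qed.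

Lemma gaussnn q n : 0 <= q -> gauss q n n = 1.
Proof.
move=> q0; rewrite /gauss leqnn /qbinom subnn qfact0 mulr1 divff //.
by rewrite gt_eqF ?qfact_gt0.
Qed.

Lemma gauss_ge0 q n k : 0 <= q -> 0 <= gauss q n k.
Proof.
move=> q0; rewrite /gauss; case: ifP => // _.
by rewrite divr_ge0 ?mulr_ge0 ?ltW ?qfact_gt0.
Qed.

Lemma gauss_absorb q n k : 0 <= q ->
  qint q k.+1 * gauss q n.+1 k.+1 = qint q n.+1 * gauss q n k.
Proof.
move=> q0; rewrite /gauss ltnS; case: ifP => kn; last by rewrite !mulr0.
rewrite /qbinom subSS !qfactS.
have := qfact_gt0 k q0; have := qfact_gt0 (n - k) q0.
have := qintS_gt0 k q0; have := qintS_gt0 n q0 => *.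
by field; rewrite !gt_eqF.
Qed.

Lemma gauss_absorb_compl q n k : 0 <= q -> (k <= n)%N ->
  qint q (n.+1 - k) * gauss q n.+1 k = qint q n.+1 * gauss q n k.
Proof.
move=> q0 kn; rewrite /gauss (leqW kn) kn /qbinom subSn // !qfactS.
have := qfact_gt0 k q0; have := qfact_gt0 (n - k) q0.
have := qintS_gt0 (n - k) q0; have := qintS_gt0 n q0 => *.
by field; rewrite !gt_eqF.
Qed.

(** After multiplication by [n+1], the two absorption identities turn the right side into [n-k] +
    q^(n-k) [k+1] times the Gaussian binomial on the left, and that factor is [n+1]. *)
Lemma gauss_pascal q n k : 0 <= q ->
  gauss q n.+1 k.+1 = gauss q n k.+1 + q ^+ (n - k) * gauss q n k.
Proof.
move=> q0; have [nk|] := ltnP n k.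
  by rewrite !gauss_small ?mulr0 ?addr0 // ltnW.
rewrite leq_eqVlt => /predU1P[->|kn].
  by rewrite !gaussnn // subnn gauss_small // add0r mul1r.
have n0 := qintS_gt0 n q0.
apply: (mulfI (lt0r_neq0 n0)).
rewrite mulrDr -gauss_absorb_compl // mulrCA -gauss_absorb //.
by rewrite mulrA -mulrDl subSS -qintD (subnK (leqW kn)) 1?addnC ?subnSK // addnS subnK // ltnW.
Qed.

(** * The products (-u; q)_n and sums over their q-binomial expansion *)

Definition qprod q u n : R := \prod_(0 <= j < n) (1 + q ^+ j * u).

Lemma qprod0 q u : qprod q u 0 = 1.
Proof. by rewrite /qprod big_geq. Qed.

Lemma qprodS q u n : qprod q u n.+1 = qprod q u n * (1 + q ^+ n * u).
Proof. by rewrite /qprod big_nat_recr. Qed.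

Lemma qprodSl q u n : qprod q u n.+1 = (1 + u) * qprod q (q * u) n.
Proof.
rewrite /qprod big_nat_recl // expr0 mul1r; congr (_ * _).
by apply: eq_bigr => j _; rewrite mulrA -exprSr.
Qed.

Lemma qprod_ge1 q u n : 0 <= q -> 0 <= u -> 1 <= qprod q u n.
Proof.
move=> q0 u0; elim: n => [|n IH]; first by rewrite qprod0.
rewrite qprodS (le_trans IH)// ler_peMr ?(le_trans ler01)//.
by rewrite lerDl mulr_ge0 ?exprn_ge0.
Qed.

(** The k-th summand of (-u; q)_n in the q-binomial theorem. Divided by [qprod q u n] these are the
    Lupas weights, so [qsum] is an expectation before normalisation. *)
Definition qterm q u n k : R := gauss q n k * q ^+ 'C(k, 2) * u ^+ k.

Definition qsum q u n (h : nat -> R) : R := \sum_(k < n.+1) qterm q u n k * h k.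

Lemma qterm_ge0 q u n k : 0 <= q -> 0 <= u -> 0 <= qterm q u n k.
Proof. by move=> q0 u0; rewrite !mulr_ge0 ?exprn_ge0 ?gauss_ge0. Qed.

Lemma qterm0 q u n : 0 <= q -> qterm q u n 0 = 1.
Proof. by move=> q0; rewrite /qterm gauss0 // !expr0 !mulr1. Qed.

Lemma qterm_small q u n k : (n < k)%N -> qterm q u n k = 0.
Proof. by move=> nk; rewrite /qterm gauss_small // !mul0r. Qed.

Lemma qtermS q u n k : 0 <= q ->
  qterm q u n.+1 k.+1 = qterm q u n k.+1 + q ^+ n * u * qterm q u n k.
Proof.
move=> q0; rewrite /qterm gauss_pascal // binS bin1.
have [nk|kn] := ltnP n k.
  by rewrite !(@gauss_small _ n) ?(leqW nk) //; ring.
have -> : q ^+ n = q ^+ (n - k) * q ^+ k by rewrite -exprD subnK.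
by rewrite exprD exprS; ring.
Qed.

Lemma qtermS_absorb q u n k : 0 <= q ->
  qterm q u n.+1 k.+1 * qint q k.+1 = qint q n.+1 * u * qterm q (q * u) n k.
Proof.
move=> q0; rewrite /qterm binS bin1 exprMn exprD exprS.
transitivity (qint q k.+1 * gauss q n.+1 k.+1 * q ^+ 'C(k, 2) * q ^+ k * u * u ^+ k).
  by ring.
by rewrite gauss_absorb //; ring.
Qed.

(** The next factor of [qprod] spreads a sum of degree n over the powers of u up to n+1. This puts
    consecutive Lupas operators over one denominator and, for h = 1, is the induction step of the
    q-binomial theorem. *)
Lemma qsum_pascal q u n h : 0 <= q ->
  qsum q u n h * (1 + q ^+ n * u) =
  \sum_(k < n.+2) (qterm q u n k * h k +
    (if (k : nat) is j.+1 then q ^+ n * u * qterm q u n j * h j else 0)).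
Proof.
move=> q0; rewrite big_split /= big_ord_recr /= qterm_small // mul0r addr0.
rewrite [X in _ = _ + X]big_ord_recl /= add0r mulrDr mulr1; congr (_ + _).
by rewrite /qsum mulr_suml; apply: eq_bigr => i _; ring.
Qed.

Lemma qsum1 q u n : 0 <= q -> qsum q u n (fun=> 1) = qprod q u n.
Proof.
move=> q0; elim: n => [|n IH].
  by rewrite /qsum big_ord1 qterm0 // qprod0 mulr1.
rewrite qprodS -IH qsum_pascal //; apply: eq_bigr => -[[|k] /= _] _.
  by rewrite !qterm0 // addr0.
by rewrite qtermS //; ring.
Qed.

(** The q-analogue of k C(n, k) = n C(n-1, k-1): weighting by [k] lowers the degree by one and
    replaces the odds u by q u. Iterating it computes moments. *)
Lemma qsum_qint q u n (h : nat -> R) : 0 <= q ->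
  qsum q u n.+1 (fun k => qint q k * h k) =
  qint q n.+1 * u * qsum q (q * u) n (fun k => h k.+1).
Proof.
move=> q0; rewrite /qsum big_ord_recl qint0 mul0r mulr0 add0r mulr_sumr.
apply: eq_bigr => i _; rewrite /= /bump /= add1n.
by rewrite mulrA qtermS_absorb //; ring.
Qed.

Lemma eq_qsum q u n (h h' : nat -> R) :
  (forall k, (k <= n)%N -> h k = h' k) -> qsum q u n h = qsum q u n h'.
Proof. by move=> hh'; apply: eq_bigr => i _; rewrite hh' // -ltnS. Qed.

Lemma qsumD q u n (h h' : nat -> R) :
  qsum q u n (fun k => h k + h' k) = qsum q u n h + qsum q u n h'.
Proof. by rewrite -big_split; apply: eq_bigr => i _; rewrite mulrDr. Qed.

Lemma qsumZ q u n c (h : nat -> R) :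
  qsum q u n (fun k => c * h k) = c * qsum q u n h.
Proof. by rewrite mulr_sumr; apply: eq_bigr => i _; rewrite mulrCA. Qed.

Lemma ler_qsum q u n (h h' : nat -> R) : 0 <= q -> 0 <= u ->
  (forall k, (k <= n)%N -> h k <= h' k) -> qsum q u n h <= qsum q u n h'.
Proof.
move=> q0 u0 hh'; apply: ler_sum => i _.
by rewrite ler_wpM2l ?qterm_ge0 // hh' // -ltnS.
Qed.

End QIntegers.

(** * The Lupas operator in odds form and the difference of consecutive degrees *)

Section LupasDifference.
Context {R : realType}.
Implicit Types (q u x : R) (f : R -> R) (n m k j N : nat).

(* The Lupas operator as a function of the odds u = x / (1 - x). *)
Definition lupas_odds q u n f : R :=
  qsum q u n (fun k => f (qint q k / qint q n)) / qprod q u n.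

Lemma lupasE q n f x : (0 < n)%N -> x != 1 ->
  lupas q n f x = lupas_odds q (x / (1 - x)) n f.
Proof.
case: n => // n _ x1.
have {x1}y0 : 1 - x != 0 by rewrite subr_eq0 eq_sym.
set u := x / (1 - x).
(* Since (1 - x)(1 + u) = 1, the factor j = 0 of [qprod] drops out, in accordance with the product
   in [lupas] starting at j = 1. *)
have den : \prod_(1 <= j < n.+1) (1 - x + q ^+ j * x) =
    (1 - x) ^+ n.+1 * qprod q u n.+1.
  rewrite qprodSl exprS mulrACA mulrDr mulr1 [(1 - x) * u]mulrC divfK //.
  rewrite subrK mul1r big_add1 /= /qprod big_nat.
  rewrite (eq_bigr (fun j => (1 - x) * (1 + q ^+ j * (q * u)))) => [|j _].
    by rewrite -big_nat big_split prodr_const_nat subn0.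
  by rewrite /u exprSr; field.
rewrite /lupas den /lupas_odds /qsum mulr_suml.
apply: eq_bigr => -[k /= kn] _; rewrite gaussE // -bin2 /qterm.
have xE : x ^+ k * (1 - x) ^+ (n.+1 - k) = u ^+ k * (1 - x) ^+ n.+1.
  rewrite -[in RHS](subnKC (_ : k <= n.+1)%N) // exprD mulrA -exprMn.
  by rewrite divfK.
rewrite -[q ^+ _ * x ^+ k * _]mulrA xE invfM.
have Y0 : (1 - x) ^+ n.+1 != 0 by rewrite expf_neq0.
move: ((1 - x) ^+ n.+1) (qprod q u n.+1)^-1 (u ^+ k) Y0 => Y D U Y0.
by field.
Qed.

Definition divdiff2 f b c a : R :=
  (f a - f c) / ((a - c) * (a - b)) - (f c - f b) / ((c - b) * (a - b)).

(** Over the common denominator, the coefficient of u^(j+1) involves f only at [j]/[N+1],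
    [j+1]/[N+2] and [j+1]/[N+1], with weights that annihilate affine functions. Hence it is a
    multiple of a second divided difference. *)
Lemma lupas_odds_diff q u N f : 0 < q -> 0 <= u ->
  lupas_odds q u N.+1 f - lupas_odds q u N.+2 f =
  q ^+ N.+1 * u / (qint q N.+1 * qint q N.+2 * qprod q u N.+2) *
  qsum q (q ^+ 2 * u) N (fun j => divdiff2 f (qint q j / qint q N.+1)
    (qint q j.+1 / qint q N.+2) (qint q j.+1 / qint q N.+1)).
Proof.
move=> qgt0 u0; have q0 := ltW qgt0.
have D1 : qprod q u N.+2 != 0.
  by rewrite gt_eqF // (lt_le_trans ltr01) ?qprod_ge1.
have D0 : qprod q u N.+1 != 0.
  by rewrite gt_eqF // (lt_le_trans ltr01) ?qprod_ge1.
have d0 : 1 + q ^+ N.+1 * u != 0.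
  by rewrite gt_eqF // (lt_le_trans ltr01) ?lerDl ?mulr_ge0 ?exprn_ge0.
have -> : lupas_odds q u N.+1 f =
    qsum q u N.+1 (fun k => f (qint q k / qint q N.+1)) * (1 + q ^+ N.+1 * u)
    / qprod q u N.+2.
  by rewrite /lupas_odds [qprod q u N.+2]qprodS; field; rewrite D0 d0.
rewrite qsum_pascal // /lupas_odds -mulrBl.
apply: (mulIf D1); rewrite mulfVK // [RHS]mulrAC.
have m0 : qint q N.+1 != 0 by rewrite gt_eqF ?qintS_gt0.
have m1 : qint q N.+2 != 0 by rewrite gt_eqF ?qintS_gt0.
rewrite [X in _ = X * _](_ : _ = q ^+ N.+1 * u / (qint q N.+1 * qint q N.+2)); last first.
  by field; rewrite m0 m1 D1.
(* The extreme terms k = 0 and k = N+2 cancel: both operators take the values f 0 and f 1 there with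
   equal weights. The remaining k is j+1 with j <= N. *)
rewrite /qsum -sumrB big_ord_recl big_ord_recr /= /bump /= !add1n.
rewrite !qterm0 // qint0 !mul0r addr0 subrr add0r !add0n !divff //.
rewrite (@qtermS _ q u N.+1 N.+1) // !(@qterm_small _ q u N.+1 N.+2) // mul0r !add0r subrr addr0.
rewrite mulr_sumr.
apply: eq_bigr => -[j jN] _ /=; rewrite add1n add0n.
have k0 : qint q j.+1 != 0 by rewrite gt_eqF ?qintS_gt0.
have s0 : qint q (N.+1 - j) != 0 by rewrite subSn // gt_eqF ?qintS_gt0.
have P0 : q ^+ j != 0 by rewrite expf_neq0 // gt_eqF.
have Q0 : q ^+ (N.+1 - j) != 0 by rewrite expf_neq0 // gt_eqF.
(* Everything is reduced to [G] and to [N+1-j], q^(N+1-j), [j], q^j, leaving a rational identity in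
   independent quantities. *)
set G := gauss q N j.
have g1 : gauss q N.+1 j.+1 = qint q N.+1 * G / qint q j.+1.
  by apply: (mulfI k0); rewrite gauss_absorb // [RHS]mulrC divfK.
have g2 : gauss q N.+1 j = qint q N.+1 * G / qint q (N.+1 - j).
  by apply: (mulfI s0); rewrite gauss_absorb_compl // [RHS]mulrC divfK.
have g3 : gauss q N.+2 j.+1 =
    qint q N.+2 * (qint q N.+1 * G / qint q (N.+1 - j)) / qint q j.+1.
  by apply: (mulfI k0); rewrite gauss_absorb // g2 [RHS]mulrC divfK.
have e1 : qint q N.+1 = qint q (N.+1 - j) + q ^+ (N.+1 - j) * qint q j.
  by rewrite -qintD subnK // ltnW.
have e2 : qint q N.+2 = qint q (N.+1 - j) + q ^+ (N.+1 - j) * qint q j.+1.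
  by rewrite -qintD addnS subnK // ltnW.
have e3 : q ^+ N.+1 = q ^+ (N.+1 - j) * q ^+ j.
  by rewrite -exprD subnK // ltnW.
rewrite /qterm g1 g2 g3 binS bin1 (exprMn _ (q ^+ 2) u) exprD exprS.
rewrite -[(q ^+ 2) ^+ j]exprM mulnC exprM.
rewrite /divdiff2 -/G.
move: (f _) (f (qint q j.+1 / qint q N.+2)) (f (qint q j / qint q N.+1)).
move=> fa fc fb.
rewrite e3; move: m0 m1 k0; rewrite e1 e2 qintSr.
move: (qint q (N.+1 - j)) (q ^+ (N.+1 - j)) (qint q j) (q ^+ j) s0 Q0 P0.
move=> s Q J P s0 Q0 P0 m0 m1 k0.
(* The divided difference divides by the gaps between its nodes; in factored form these are visibly
   nonzero. *)
have -> : (J + P) / (s + Q * J) - (J + P) / (s + Q * (J + P)) =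
  (J + P) * (P * Q) / ((s + Q * J) * (s + Q * (J + P))) by field; rewrite m0 m1.
have -> : (J + P) / (s + Q * J) - J / (s + Q * J) = P / (s + Q * J) by field.
have -> : (J + P) / (s + Q * (J + P)) - J / (s + Q * J) =
  P * s / ((s + Q * J) * (s + Q * (J + P))) by field; rewrite m0 m1.
by field; rewrite m0 m1 k0 s0 Q0 P0.
Qed.

(** * Moments of [k] under the Lupas weights *)

Lemma qsum_mean q u n : 0 <= q -> 0 <= u ->
  qsum q u n (qint q) = qint q n * (u / (1 + u)) * qprod q u n.
Proof.
move=> q0 u0; case: n => [|n].
  by rewrite /qsum big_ord1 qint0 mulr0 !mul0r.
transitivity (qsum q u n.+1 (fun k => qint q k * 1)).
  by apply: eq_qsum => k _; rewrite mulr1.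
rewrite qsum_qint // qsum1 // qprodSl.
by field; rewrite gt_eqF // (lt_le_trans ltr01) ?lerDl.
Qed.

(** Splitting off one factor [k] by [qsum_qint] leaves a mean at odds q u, and q u / (1 + q u) <= u
    / (1 + u) is the only loss. With s = u / (1 + u), the variance is thus at most [n] s (1 - s). *)
Lemma qsum_moment2 q u n : 0 <= q <= 1 -> 0 <= u ->
  qsum q u n (fun k => qint q k ^+ 2) <=
  qint q n * (u / (1 + u)) * (1 + (qint q n - 1) * (u / (1 + u))) * qprod q u n.
Proof.
move=> /andP[q0 q1] u0; case: n => [|n].
  by rewrite /qsum big_ord1 qint0 expr0n /= mulr0 !mul0r.
rewrite (@qsum_qint _ q u n (qint q)) //.
rewrite (@eq_qsum _ _ _ _ _ (fun k => 1 + q * qint q k)) => [|k _]; last exact: qintS.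
have qu0 : 0 <= q * u by rewrite mulr_ge0.
have u1 : 0 < 1 + u by rewrite (lt_le_trans ltr01) ?lerDl.
have qu1 : 0 < 1 + q * u by rewrite (lt_le_trans ltr01) ?lerDl.
rewrite qsumD qsumZ qsum1 // qsum_mean // qprodSl.
have -> : qint q n.+1 - 1 = q * qint q n by rewrite qintS; ring.
set D := qprod _ _ n; have D0 : 0 <= D by rewrite (le_trans ler01) ?qprod_ge1.
rewrite [leRHS](_ : _ =
  qint q n.+1 * u * (D + q * (qint q n * (u / (1 + u)) * D))); last first.
  by field; rewrite gt_eqF.
rewrite ler_wpM2l ?mulr_ge0 ?qint_ge0 // lerD2l ler_wpM2l // ler_wpM2r //.
rewrite ler_wpM2l ?qint_ge0 // ler_pdivrMr // mulrAC ler_pdivlMr //.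
have : q * u <= u by rewrite ler_piMl.
lra.
Qed.

(** The second moment about [N+1] u / (1 + u) is the variance, at most [N], plus the squared bias
    due to the odds q^2 u and the degree N. The bias is at most 3 for every q, and [N] + 9 <= 10
    [N+1]. *)
Lemma qsum_deviation q u N : 0 < q < 1 -> 0 <= u ->
  qsum q (q ^+ 2 * u) N
    (fun j => (qint q j - qint q N.+1 * (u / (1 + u))) ^+ 2) <=
  10 * qint q N.+1 * qprod q (q ^+ 2 * u) N.
Proof.
move=> /andP[qgt0 qlt1] u0; have q0 := ltW qgt0; have q1 := ltW qlt1.
set v := q ^+ 2 * u; set a := _ * (u / _).
have v0 : 0 <= v by rewrite mulr_ge0 ?exprn_ge0.
rewrite (@eq_qsum _ _ _ _ _ (fun j => qint q j ^+ 2 + ((- (2 * a)) * qint q j + a ^+ 2 * 1))); last first.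
  by move=> k _; ring.
rewrite !qsumD !qsumZ qsum1 // qsum_mean //.
set D := qprod _ _ _; have D0 : 0 <= D by rewrite (le_trans ler01) ?qprod_ge1.
set s := v / (1 + v).
have := @qsum_moment2 q v N _ v0; rewrite q0 q1 => /(_ isT).
rewrite -/s -/D => M2.
apply: (@le_trans _ _ ((qint q N * s * (1 - s) + (a - qint q N * s) ^+ 2) * D)).
  by move: M2; set E := qsum _ _ _ _ => M2; nra.
rewrite ler_wpM2r //.
have u1 : 0 < 1 + u by rewrite (lt_le_trans ltr01) ?lerDl.
have v1 : 0 < 1 + v by rewrite (lt_le_trans ltr01) ?lerDl.
have s01 : 0 <= s <= 1.
  by rewrite /s divr_ge0 ?(ltW v1) // ler_pdivrMr // mul1r lerDr ler01.
have x01 : 0 <= u / (1 + u) <= 1.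
  by rewrite divr_ge0 ?(ltW u1) // ler_pdivrMr // mul1r lerDr ler01.
(* The bias does not grow with N, because the difference of the two means carries a factor 1 - q and
   (1 - q) [N] = 1 - q^N. The summands are at most 2 and 1. *)
have aE : a - qint q N * s =
    ((1 - q) * qint q N) * (1 + q) * (u / (1 + u) * (1 + v)^-1) + q ^+ N * (u / (1 + u)).
  by rewrite /a /s qintSr /v; field; rewrite !gt_eqF.
have d03 : 0 <= a - qint q N * s <= 3.
  have qN : 0 <= q ^+ N <= 1 by rewrite exprn_ge0 // exprn_ile1.
  have iv : 0 <= (1 + v)^-1 <= 1 by rewrite invr_ge0 ltW //= invf_le1 // lerDl.
  rewrite aE qint_mul1B; move: (u / _) x01 (q ^+ N) qN (1 + v)^-1 iv.
  move=> x /andP[x0 x1] p /andP[p0 p1] i /andP[i0 i1].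
  have xi0 : 0 <= x * i by rewrite mulr_ge0.
  have xi1 : x * i <= 1 by rewrite mulr_ile1.
  have t0 : 0 <= (1 - p) * (1 + q) by rewrite mulr_ge0; lra.
  have t2 : (1 - p) * (1 + q) <= 2 by nra.
  have w0 : 0 <= (1 - p) * (1 + q) * (x * i) by rewrite mulr_ge0.
  have w2 : (1 - p) * (1 + q) * (x * i) <= 2 by nra.
  have z0 : 0 <= p * x by rewrite mulr_ge0.
  have z1 : p * x <= 1 by rewrite mulr_ile1.
  by apply/andP; split; lra.
move/andP: d03 => [d0 d3].
have sq : (a - qint q N * s) ^+ 2 <= 9 by nra.
have ss : qint q N * s * (1 - s) <= qint q N.
  have -> : qint q N * s * (1 - s) = qint q N * (s * (1 - s)) by ring.
  rewrite ler_piMr ?qint_ge0 //; move/andP: s01 => [s0 s1]; nra.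
have := qintS_ge1 N q0; have : qint q N <= qint q N.+1 by rewrite ler_qint.
lra.
Qed.

End LupasDifference.

(** * Dominated convergence for series *)

Section Tannery.
Context {R : realType}.
Implicit Types (a : nat -> nat -> R) (b M : nat -> R).

(** Summability of [M] makes the tails past N small uniformly in n, while the finite head converges
    term by term. *)
Lemma tannery a b M : (forall n k, `|a n k| <= M k) -> cvgn (series M) ->
  (forall k, a n k @[n --> \oo] --> b k) ->
  \sum_(k < n.+1) a n k @[n --> \oo] --> limn (series b).
Proof.
move=> aM cM ab.
have M0 k : 0 <= M k by rewrite (le_trans _ (aM 0 k)).
have bM k : `|b k| <= M k.
  by apply: (cvgr_to_le (cvg_norm (ab k))); apply: nearW => n; exact: aM.
have cb : cvgn (series b).
  apply: normed_cvg; apply: (series_le_cvg _ _ _ cM) => //= n. 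
have Mle n : series M n <= limn (series M).
  apply: nondecreasing_cvgn_le => //; apply/nondecreasing_seqP => k.
  by rewrite /series /= big_nat_recr //= lerDl.
have tail (c : nat -> R) N n : (forall k, `|c k| <= M k) -> (N <= n)%N ->
    `|series c n - series c N| <= limn (series M) - series M N.
  move=> cM' Nn; rewrite sub_series_geq // (le_trans (ler_norm_sum _ _ _)) //.
  rewrite (@le_trans _ _ (series M n - series M N)) ?lerD2r //.
  by rewrite sub_series_geq // ler_sum.
apply/cvgrPdist_le => e e0.
have e4 : 0 < e / 4 by rewrite divr_gt0.
have /cvgrPdist_le/(_ _ e4) [N _ HN] := cM.
have {HN} : limn (series M) - series M N <= e / 4.
  by apply: le_trans (HN N (leqnn N)); exact: ler_norm.
set dM := _ - _ => HN.
have HB : `|limn (series b) - series b N| <= e / 4.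
  apply: le_trans HN.
  apply: (cvgr_to_le (cvg_norm (cvgB cb (cvg_cst (series b N))))).
  by exists N => // n /= Nn; exact: tail.
have : \sum_(0 <= k < N) a n k @[n --> \oo] --> series b N.
  by apply: cvg_big => // ; exact: add_continuous.
move=> /cvgrPdist_le/(_ _ e4) HS.
near=> n.
have Nn : (N <= n.+1)%N by near: n; exists N => // n /=; exact: leqW.
have -> : \sum_(k < n.+1) a n k = series (a n) n.+1 by rewrite /series /= big_mkord.
have := tail (a n) N n.+1 (aM n) Nn.
have : `|series b N - series (a n) N| <= e / 4 by near: n.
have -> : limn (series b) - series (a n) n.+1 =
  (limn (series b) - series b N) + (series b N - series (a n) N)
   - (series (a n) n.+1 - series (a n) N) by ring.
move=> h1 h2; have h3 := le_trans h2 HN.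
rewrite (le_trans (ler_normB _ _)) // (le_trans (lerD (ler_normD _ _) (lexx _))) //.
lra.
Unshelve. all: by end_near. Qed.

End Tannery.

(** * Convergence of the Lupas operators as the degree tends to infinity *)

Section LupasLimit.
Context {R : realType}.
Implicit Types (q u x : R) (f : R -> R) (n m k j N : nat).

Lemma ler_qprod_expR q u n : 0 <= q -> 0 <= u ->
  qprod q u n <= expR (qint q n * u).
Proof.
move=> q0 u0; elim: n => [|n IH]; first by rewrite qprod0 qint0 mul0r expR0.
rewrite qprodS qintSr mulrDl expRD ler_pM ?expR_ge1Dx //.
  by rewrite (le_trans ler01) ?qprod_ge1.
by rewrite addr_ge0 ?mulr_ge0 ?exprn_ge0.
Qed.

Lemma qint_le_inv1B q n : 0 < q < 1 -> qint q n <= (1 - q)^-1.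
Proof.
move=> /andP[q0 q1]; rewrite -div1r ler_pdivlMr ?subr_gt0 // mulrC qint_mul1B.
by rewrite lerBlDr lerDl exprn_ge0 // ltW.
Qed.

Lemma cvg_qint q : 0 < q < 1 -> qint q n @[n --> \oo] --> (1 - q)^-1.
Proof.
move=> /andP[q0 q1].
have q1N : 1 - q != 0 by rewrite subr_eq0 gt_eqF.
rewrite (_ : qint q = fun n => (1 - q ^+ n) / (1 - q)); last first.
  by apply/funext => n; rewrite -qint_mul1B mulrC mulKf.
rewrite -[X in _ --> X]mul1r; apply: cvgMr_tmp; rewrite -[X in _ --> X]subr0.
by apply: cvgB; [exact: cvg_cst | apply: cvg_expr; rewrite gtr0_norm].
Qed.

Lemma cvg_qprod q u : 0 < q < 1 -> 0 <= u ->
  cvg (qprod q u n @[n --> \oo]).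
Proof.
move=> q01 u0; have /andP[/ltW q0 _] := q01.
apply: nondecreasing_is_cvgn.
  apply/nondecreasing_seqP => n; rewrite qprodS ler_peMr //.
    by rewrite (le_trans ler01) ?qprod_ge1.
  by rewrite lerDl mulr_ge0 ?exprn_ge0.
exists (expR ((1 - q)^-1 * u)) => _ [n _ <-].
by rewrite (le_trans (ler_qprod_expR _ _ _)) // ler_expR ler_wpM2r // qint_le_inv1B.
Qed.

(** Induction on k by absorption, each step contributing [n+1] / [k+1] with [n+1] tending to 1 / (1
    - q). *)
Lemma cvg_gauss q k : 0 < q < 1 ->
  gauss q n k @[n --> \oo] --> ((1 - q) ^+ k * qfact q k)^-1.
Proof.
move=> q01; have /andP[/ltW q0 q1] := q01.
elim: k => [|k IH].
  rewrite expr0 qfact0 mulr1 invr1.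
  rewrite (_ : (fun n => _) = fun=> 1); first exact: cvg_cst.
  by apply/funext => n; rewrite gauss0.
rewrite -(@cvg_shiftS _ (fun n => gauss q n k.+1)) /=.
have k0 : qint q k.+1 != 0 by rewrite gt_eqF ?qintS_gt0.
rewrite (_ : (fun n => _) = fun n => qint q n.+1 * gauss q n k / qint q k.+1); last first.
  by apply/funext => n; rewrite -gauss_absorb // mulrC mulKf.
have -> : ((1 - q) ^+ k.+1 * qfact q k.+1)^-1 =
    (1 - q)^-1 * ((1 - q) ^+ k * qfact q k)^-1 / qint q k.+1.
  by rewrite exprS qfactS !invfM; ring.
apply: cvgMr_tmp; apply: cvgM => //.
by have := cvg_qint q01; rewrite -(@cvg_shiftS _ (qint q)).
Qed.

Lemma ler_natM_exprn q k : 0 <= q <= 1 -> k.+1%:R * q ^+ k <= qint q k.+1.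
Proof.
move=> /andP[q0 q1]; rewrite /qint mulr_natl -[X in _ *+ X]card_ord -sumr_const.
by apply: ler_sum => i _; rewrite ler_wiXn2l // -ltnS.
Qed.

(** Each absorption step contributes [n+1] q^k / [k+1], where [n+1] <= 1 / (1 - q) and q^k / [k+1]
    <= 1 / (k+1). The bound is uniform in n and gives an exponential series as majorant in Tannery's
    theorem. *)
Lemma ler_gauss_fact q n k : 0 < q < 1 ->
  gauss q n k * q ^+ 'C(k, 2) <= ((1 - q)^-1) ^+ k / k`!%:R.
Proof.
move=> q01; have /andP[/ltW q0 q1] := q01.
have i0 : 0 <= (1 - q)^-1 by rewrite invr_ge0 subr_ge0 ltW.
elim: k n => [|k IH] [|n].
- by rewrite gauss0 // !expr0 fact0 invr1.
- by rewrite gauss0 // !expr0 fact0 invr1.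
- by rewrite gauss_small // mul0r divr_ge0 ?exprn_ge0.
have k0 : 0 < qint q k.+1 by rewrite qintS_gt0.
have -> : gauss q n.+1 k.+1 = qint q n.+1 * gauss q n k / qint q k.+1.
  by rewrite -gauss_absorb // mulrC mulKf // gt_eqF.
rewrite binS bin1 exprD factS natrM invfM exprS.
have -> : qint q n.+1 * gauss q n k / qint q k.+1 * (q ^+ 'C(k, 2) * q ^+ k) =
  qint q n.+1 * (q ^+ k / qint q k.+1) * (gauss q n k * q ^+ 'C(k, 2)) by ring.
have -> : (1 - q)^-1 * (1 - q)^-1 ^+ k * (k.+1%:R^-1 / k`!%:R) =
  (1 - q)^-1 * k.+1%:R^-1 * ((1 - q)^-1 ^+ k / k`!%:R) by ring.
apply: ler_pM => //.
- by rewrite mulr_ge0 ?divr_ge0 ?exprn_ge0 ?qint_ge0.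
- by rewrite mulr_ge0 ?exprn_ge0 ?gauss_ge0.
apply: ler_pM; rewrite ?qint_ge0 ?qint_le_inv1B ?divr_ge0 ?exprn_ge0 ?qint_ge0 //.
by rewrite ler_pdivrMr // mulrC ler_pdivlMr ?ltr0n // mulrC ler_natM_exprn ?q0 ?ltW.
Qed.

Lemma qint_ratio01 q k n : 0 <= q -> (k <= n)%N ->
  0 <= qint q k / qint q n <= 1.
Proof.
move=> q0 kn; rewrite divr_ge0 ?qint_ge0 //=.
case: n kn => [|n kn]; first by rewrite qint0 invr0 mulr0.
by rewrite ler_pdivrMr ?qintS_gt0 // mul1r ler_qint.
Qed.

(** The limit is the body of [lupas_lim_lt1] with u for x / (1 - x). Convergence at the nodes is a
    separate hypothesis because in the application continuity holds only within [0, 1]. *)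
Lemma lupas_odds_cvg q u f (C : R) : 0 < q < 1 -> 0 <= u ->
  (forall t : R, 0 <= t <= 1 -> `|f t| <= C) ->
  (forall k, f (qint q k / qint q n) @[n --> \oo] --> f (1 - q ^+ k)) ->
  lupas_odds q u n f @[n --> \oo] -->
  limn (fun m => \sum_(0 <= k < m) f (1 - q ^+ k) *
    (q ^+ (k * k.-1)./2 * u ^+ k /
     ((1 - q) ^+ k * qfact q k *
      limn (fun m => \prod_(0 <= j < m) (1 + q ^+ j * u))))).
Proof.
move=> q01 u0 fC cf; have /andP[/ltW q0 q1] := q01.
have C0 : 0 <= C by rewrite (le_trans _ (fC 0 _)) // lexx ler01.
pose D := limn (fun n => qprod q u n).
have cD : qprod q u n @[n --> \oo] --> D by exact: cvg_qprod.
have D0 : D != 0.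
  rewrite gt_eqF // (lt_le_trans ltr01) //; apply: (cvgr_to_ge cD).
  by apply: nearW => n; rewrite qprod_ge1.
rewrite (_ : (fun n => _) = fun n => \sum_(k < n.+1)
    qterm q u n k * f (qint q k / qint q n) / qprod q u n); last first.
  by apply/funext => n; rewrite /lupas_odds /qsum mulr_suml.
pose b k := f (1 - q ^+ k) *
  (q ^+ (k * k.-1)./2 * u ^+ k / ((1 - q) ^+ k * qfact q k * D)).
(* As [qprod] is at least 1, the terms are dominated by [C] times those of the series of exp (u / (1
   - q)). *)
apply: (@tannery _
  (fun n k => qterm q u n k * f (qint q k / qint q n) / qprod q u n) b (C *: exp_coeff (u / (1 - q)))).
- move=> n k; rewrite -[(_ *: _) k]/(C * exp_coeff (u / (1 - q)) k).
  have e0 : 0 <= C * exp_coeff (u / (1 - q)) k.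
    by rewrite mulr_ge0 // exp_coeff_ge0 // divr_ge0 // subr_ge0 ltW.
  have [nk|kn] := ltnP n k; first by rewrite qterm_small // !mul0r normr0.
  have Dn := qprod_ge1 n q0 u0.
  rewrite normrM normrM normfV [`|qprod _ _ _|]ger0_norm ?(le_trans ler01) //.
  rewrite ler_pdivrMr ?(lt_le_trans ltr01) //.
  apply: (@le_trans _ _ (C * exp_coeff (u / (1 - q)) k)); last by rewrite ler_peMr.
  rewrite mulrC ler_pM ?fC ?qint_ratio01 //.
  rewrite ger0_norm ?qterm_ge0 // /qterm /exp_coeff /= expr_div_n -exprVn.
  by rewrite mulrC -mulrA ler_wpM2l ?exprn_ge0 // ler_gauss_fact.
- exact/is_cvg_seriesZ/is_cvg_series_exp_coeff.
- move=> k; rewrite /b.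
  have -> : f (1 - q ^+ k) * (q ^+ (k * k.-1)./2 * u ^+ k /
      ((1 - q) ^+ k * qfact q k * D)) =
    ((1 - q) ^+ k * qfact q k)^-1 * q ^+ 'C(k, 2) * u ^+ k * f (1 - q ^+ k) / D.
    by rewrite bin2 [in LHS]invfM; ring.
  apply: cvgM; last exact: cvgV.
  apply: cvgM; last exact: cf.
  by do 2 apply: cvgMr_tmp; exact: cvg_gauss.
Qed.

End LupasLimit.

(** * Calculus relative to [0, 1] *)

Section Calculus01.
Context {R : realType}.
Implicit Types (f : R -> R) (x y l e : R).

Lemma diff_quot01_cvgP f x l :
  (diff_quot01 f x --> l) <->
  (forall e, 0 < e -> exists2 d : R, 0 < d & forall y, 0 <= y <= 1 -> y != x ->
     `|y - x| < d -> `|l - (f y - f x) / (y - x)| <= e).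
Proof.
rewrite /diff_quot01; split=> [/cvgrPdist_le H e e0|H].
  have [d /= d0 Hd] := H e e0; exists d => // y y01 yx yxd.
  have xyd : `|x - y| < d by rewrite distrC.
  by apply: (Hd y xyd yx); rewrite /= in_itv.
apply/cvgrPdist_le => e e0; have [d d0 Hd] := H e e0.
exists d => [//|y yxd yx]; rewrite /= in_itv /= => y01.
by apply: Hd => //; rewrite distrC.
Qed.

(** Properness makes limits along this filter unique, so any limit of the difference quotient
    computes the [lim] in [deriv01]. *)
Lemma within01_dnbhs_proper x : 0 <= x <= 1 ->
  ProperFilter (within `[(0:R), 1] x^').
Proof.
move=> /andP[x0 x1]; apply: Build_ProperFilter_ex => P [d /= d0 Hd].
(* From x, move towards an endpoint at distance at least 1/2: a step of at most 1/2 stays in [0, 1],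
   and one of at most d/2 stays in the ball. *)
pose y := if x < 1 / 2 then x + Num.min (d / 2) (1 / 2)
          else x - Num.min (d / 2) (1 / 2).
have m0 : 0 < Num.min (d / 2) (1 / 2) :> R by rewrite lt_min !divr_gt0.
have md : Num.min (d / 2) (1 / 2) <= d / 2 by rewrite ge_min lexx.
have m1 : Num.min (d / 2) (1 / 2) <= 1 / 2 :> R by rewrite ge_min lexx orbT.
exists y; apply: Hd.
- by rewrite /= /y; case: ifP => _; [rewrite distrC addrAC subrr add0r|
    rewrite subKr]; rewrite gtr0_norm //; lra.
- by rewrite /y; case: ifP => _; [rewrite gt_eqF | rewrite lt_eqF]; lra.
- rewrite /= in_itv /= /y; case: ifPn; rewrite -?leNgt => *; apply/andP; split; lra.
Qed.

Lemma deriv01_eq f x l : 0 <= x <= 1 -> diff_quot01 f x --> l ->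
  derivable01 f x /\ deriv01 f x = l.
Proof.
move=> x01 fl; have FF := within01_dnbhs_proper x01.
by split; [apply: cvgP fl | apply: (cvg_lim _ fl)].
Qed.

(** The scalar [s] lets this serve twice: with 1 for the reflected function, and with -1 for its
    derivative, whose formula holds on [0, 1]. *)
Lemma diff_quot01_reflect f (g : R -> R) (s : R) x : 0 <= x <= 1 ->
  {in `[0, 1], forall y, g y = s * f (1 - y)} ->
  derivable01 f (1 - x) -> diff_quot01 g x --> - (s * deriv01 f (1 - x)).
Proof.
move=> x01 gE /diff_quot01_cvgP H; apply/diff_quot01_cvgP => e e0.
have s0 : 0 < `|s| + 1 by rewrite ltr_wpDl.
have [d d0 Hd] := H (e / (`|s| + 1)) (divr_gt0 e0 s0).
exists d => // y y01 yx yxd.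
rewrite !gE ?in_itv //=.
have yx0 : y - x != 0 by rewrite subr_eq0.
have -> : - (s * deriv01 f (1 - x)) - (s * f (1 - y) - s * f (1 - x)) / (y - x) =
   - s * (lim (diff_quot01 f (1 - x)) - (f (1 - y) - f (1 - x)) / (1 - y - (1 - x))).
  rewrite /deriv01; have -> : 1 - y - (1 - x) = - (y - x) by ring.
  by rewrite invrN; ring.
rewrite normrM normrN.
have h : `|lim (diff_quot01 f (1 - x)) - (f (1 - y) - f (1 - x)) / (1 - y - (1 - x))|
   <= e / (`|s| + 1).
  apply: Hd; first by move: y01 => /andP[? ?]; apply/andP; split; lra.
    by apply: contra yx => /eqP h; apply/eqP; lra.
  have -> : 1 - y - (1 - x) = - (y - x) by ring.
  by rewrite normrN.
apply: (@le_trans _ _ (`|s| * (e / (`|s| + 1)))); first by rewrite ler_wpM2l.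
by rewrite mulrCA ler_piMr ?ltW // ltr_pdivrMr // mul1r ltrDl.
Qed.

Lemma onem01 x : 0 <= x <= 1 -> 1 - x \in `[0, 1].
Proof.
by move=> /andP[? ?]; rewrite in_itv /=; apply/andP; split; lra.
Qed.

Lemma deriv01_reflect f x : 0 <= x <= 1 -> derivable01 f (1 - x) ->
  derivable01 (fun y => f (1 - y)) x /\
  deriv01 (fun y => f (1 - y)) x = -1 * deriv01 f (1 - x).
Proof.
move=> x01 df; have /(deriv01_eq x01)[? ->] :=
  @diff_quot01_reflect f (fun z => f (1 - z)) 1 x x01 (fun z _ => esym (mul1r _)) df.
by rewrite mulN1r mul1r.
Qed.

Lemma deriv2_01_reflect f x : C2_01 f -> 0 <= x <= 1 ->
  derivable01 (deriv01 (fun y => f (1 - y))) x /\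
  deriv01 (deriv01 (fun y => f (1 - y))) x = deriv01 (deriv01 f) (1 - x).
Proof.
move=> [d1 d2 _] x01.
have e1 : {in `[0, 1], forall y,
    deriv01 (fun z => f (1 - z)) y = -1 * deriv01 f (1 - y)}.
  move=> y; rewrite in_itv /= => y01.
  by have [] := deriv01_reflect y01 (d1 _ (onem01 y01)).
have /(deriv01_eq x01)[? ->] := diff_quot01_reflect x01 e1 (d2 _ (onem01 x01)).
by rewrite mulN1r opprK.
Qed.

Lemma C2_01_reflect f : C2_01 f -> C2_01 (fun y => f (1 - y)).
Proof.
move=> Cf; have [d1 d2 c2] := Cf.
split=> [y|y|]; rewrite ?in_itv /=.
- by move=> y01; have [] := deriv01_reflect y01 (d1 _ (onem01 y01)).
- by move=> y01; have [] := deriv2_01_reflect Cf y01.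
apply/subspace_continuousP => x /=; rewrite in_itv /= => x01.
have /subspace_continuousP/(_ _ (onem01 x01)) := c2.
move=> /cvgrPdist_le H; apply/cvgrPdist_le => e e0.
have [d /= d0 Hd] := H e e0; exists d => [//|y yxd]; rewrite /= in_itv /= => y01.
change (`|deriv01 (deriv01 (fun z => f (1 - z))) x -
  deriv01 (deriv01 (fun z => f (1 - z))) y| <= e).
rewrite (deriv2_01_reflect Cf x01).2 (deriv2_01_reflect Cf y01).2.
apply: Hd => /=; last exact: onem01.
have -> : 1 - x - (1 - y) = - (x - y) by ring.
by rewrite normrN.
Qed.

Lemma derivable01_is_derive f x : 0 < x < 1 -> derivable01 f x ->
  is_derive x (1 : R) f (deriv01 f x).
Proof.
move=> /andP[x0 x1] /diff_quot01_cvgP H.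
have H' : (fun h : R => h^-1 *: ((f \o shift x) (h *: (1 : R)) - f x)) @ 0^'
    --> deriv01 f x.
  apply/cvgrPdist_le => e e0; have [d d0 Hd] := H e e0.
  (* The bounds x and 1 - x keep x + h inside [0, 1], where the relative difference quotient is
     controlled. *)
  exists (Num.min d (Num.min x (1 - x))) => /=; first by rewrite !lt_min d0 x0 subr_gt0.
  move=> h /=; rewrite sub0r normrN !lt_min => /and3P[hd hx hx1] h0.
  have -> : h^-1 *: (f (h *: (1 : R) + x) - f x) = (f (h + x) - f x) / (h + x - x).
    by rewrite addrK /GRing.scale /= mulr1 mulrC.
  apply: Hd; last by rewrite addrK.
    move: hx hx1; rewrite !ltr_norml => /andP[? ?] /andP[? ?].
    by apply/andP; split; lra.
  by rewrite -subr_eq0 addrK.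
by apply: DeriveDef; [apply: cvgP H' | apply: cvg_lim H'].
Qed.

Lemma derivable01_continuous f : {in `[0, 1], forall x, derivable01 f x} ->
  {within `[0, 1], continuous f}.
Proof.
move=> df; apply/subspace_continuousP => x /=; rewrite in_itv /= => x01.
have /diff_quot01_cvgP H : derivable01 f x by apply: df; rewrite in_itv.
(* Tolerance 1 bounds the difference quotients near x by |l| + 1, a Lipschitz estimate at x. *)
have [d d0 Hd] := H 1 ltr01.
set l := lim _ in Hd.
have l0 : 0 < `|l| + 1 by rewrite ltr_wpDl.
apply/cvgrPdist_le => e e0.
exists (Num.min d (e / (`|l| + 1))) => /=; first by rewrite lt_min d0 divr_gt0.
move=> y /=; rewrite lt_min => /andP[yd ye]; rewrite in_itv /= => y01.
have [->|yx] := eqVneq y x; first by rewrite subrr normr0 ltW.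
have := Hd y y01 yx; rewrite distrC => /(_ yd) h.
have yx0 : y - x != 0 by rewrite subr_eq0.
have -> : f x - f y = (l - (f y - f x) / (y - x) - l) * (y - x) by field.
rewrite normrM; apply: (@le_trans _ _ ((`|l| + 1) * `|y - x|)).
  by rewrite ler_wpM2r // (le_trans (ler_normB _ _)) // addrC lerD2l.
by move: ye; rewrite ltr_pdivlMr // mulrC distrC => /ltW.
Qed.

(* Rolle's theorem, applied to f minus its quadratic interpolant at b, c, a. *)
Lemma divdiff2_mean f b c a : C2_01 f -> 0 <= b -> b < c -> c < a -> a <= 1 ->
  exists2 xi, b <= xi <= a & divdiff2 f b c a = deriv01 (deriv01 f) xi / 2.
Proof.
move=> [d1 d2 _] b0 bc ca a1.
set kap := divdiff2 f b c a.
(* Newton's form of the interpolant, up to its constant term: [F] takes one common value at the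
   three nodes. *)
pose lam := (f c - f b) / (c - b) - kap * (b + c).
pose P t := kap * t ^+ 2 + lam * t.
pose F := f - P.
have cb0 : c - b != 0 by rewrite subr_eq0 gt_eqF.
have ac0 : a - c != 0 by rewrite subr_eq0 gt_eqF.
have ab0 : a - b != 0 by rewrite subr_eq0 gt_eqF // (lt_trans bc).
have Fbc : F b = F c.
  by rewrite /F /P /lam !fctE; field.
have Fca : F c = F a.
  rewrite /F /P /lam /kap /divdiff2 !fctE; field.
  by rewrite cb0 ac0 ab0.
have dP x : is_derive x (1 : R) P (2 * kap * x + lam).
  by apply: is_derive_eq; rewrite /GRing.scale /=; ring.
have dF x : 0 < x < 1 -> is_derive x (1 : R) F (deriv01 f x - (2 * kap * x + lam)).
  move=> x01; have ? : is_derive x (1 : R) f (deriv01 f x).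
    apply: derivable01_is_derive => //; apply: d1.
    by move: x01 => /andP[? ?]; rewrite in_itv /= !ltW.
  exact: is_deriveB.
have cF : {within `[0, 1], continuous F}.
  have cP : {within `[0, 1], continuous P}.
    by apply: derivable_within_continuous => y _; apply: ex_derive.
  apply/subspace_continuousP => x xA; apply: cvgB.
    by move/subspace_continuousP : (derivable01_continuous d1); exact.
  by move/subspace_continuousP : cP; exact.
have rolle s t : 0 <= s -> s < t -> t <= 1 -> F s = F t ->
    exists2 z, s < z < t & deriv01 f z = 2 * kap * z + lam.
  move=> s0 st t1 Fst.
  have [|||z] := @Rolle _ F s t st.
  - move=> x; rewrite in_itv /= => /andP[sx xt].
    have [] // := dF x; apply/andP; split; lra.
  - apply: continuous_subspaceW cF => x /=; rewrite !in_itv /= => /andP[sx xt].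
    by apply/andP; split; lra.
  - exact: Fst.
  rewrite in_itv /= => /andP[sz zt] Fz; exists z; first by rewrite sz.
  have z01 : 0 < z < 1 by apply/andP; split; lra.
  have := @derive_val _ _ _ _ _ _ _ Fz; rewrite (@derive_val _ _ _ _ _ _ _ (dF z z01)).
  by move/eqP; rewrite subr_eq0 => /eqP.
have [y1 /andP[by1 y1c] Dy1] := rolle b c b0 bc (ltW (lt_le_trans ca a1)) Fbc.
have [y2 /andP[cy2 y2a] Dy2] := rolle c a (ltW (le_lt_trans b0 bc)) ca a1 Fca.
have y12 : y1 < y2 by rewrite (lt_trans y1c).
(* At [y1] and [y2] the derivative of f agrees with an affine function of slope 2 [kap], so the mean
   value theorem yields a point where the second derivative is 2 [kap]. *)
have [||xi] := @MVT _ (deriv01 f) (deriv01 (deriv01 f)) y1 y2 y12.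
- move=> x; rewrite in_itv /= => /andP[? ?].
  apply: derivable01_is_derive; first by apply/andP; split; lra.
  by apply: d2; rewrite in_itv /=; apply/andP; split; lra.
- have := derivable01_continuous d2; apply: continuous_subspaceW => x /=.
  by rewrite !in_itv /= => /andP[sx xt]; apply/andP; split; lra.
rewrite in_itv /= => /andP[y1x xy2].
have -> : deriv01 f y2 - deriv01 f y1 = 2 * kap * (y2 - y1) by rewrite Dy1 Dy2; ring.
have y210 : y2 - y1 != 0 by rewrite subr_eq0 gt_eqF.
move=> /(mulIf y210) kapE; exists xi; first by apply/andP; split; lra.
by rewrite -kapE; field.
Qed.

(** * Boundedness and the modulus of continuity *)

Lemma within01_bounded f : {within `[0, 1], continuous f} ->
  exists2 C : R, 0 <= C & forall x, 0 <= x <= 1 -> `|f x| <= C.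
Proof.
move=> cf; have [M _ HM] := EVT_max ler01 cf; have [m _ Hm] := EVT_min ler01 cf.
exists (`|f M| + `|f m|) => [|x x01]; first by rewrite addr_ge0.
have := HM x; have := Hm x; rewrite in_itv /= => /(_ x01) h1 /(_ x01) h2.
have := ler_norm (f M); have := ler_norm (- f m); rewrite normrN => h3 h4.
have := normr_ge0 (f M); have := normr_ge0 (f m) => h5 h6.
by rewrite ler_norml; apply/andP; split; lra.
Qed.

(** Continuity on the compact interval bounds the set in [modulus], so that its [sup] is an upper
    bound. *)
Lemma le_modulus f (t : R) x y : {within `[0, 1], continuous f} ->
  0 <= x <= 1 -> 0 <= y <= 1 -> `|x - y| <= t -> `|f x - f y| <= modulus f t.
Proof.
move=> cf x01 y01 xyt; have [C C0 fC] := within01_bounded cf.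
apply: ub_le_sup; last by exists x, y; split; rewrite ?in_itv.
exists (C + C) => _ [u [v [+ + _ ->]]]; rewrite !in_itv /= => u01 v01.
by rewrite (le_trans (ler_normB _ _)) // lerD ?fC.
Qed.

(** The segment from x to y is cut into N equal pieces of length at most t; the induction peels off
    the piece at x. *)
Lemma modulus_chain f (t : R) N x y : {within `[0, 1], continuous f} -> 0 <= t ->
  0 <= x <= 1 -> 0 <= y <= 1 -> `|x - y| <= N%:R * t ->
  `|f x - f y| <= N%:R * modulus f t.
Proof.
move=> cf t0; elim: N x => [|N IH] x x01 y01.
  by rewrite !mul0r !normr_le0 !subr_eq0 => /eqP ->.
set N1 : R := N.+1%:R => xy.
have N0 : (0 : R) < N1 by rewrite ltr0n.
have NE : N1 = N%:R + 1 by rewrite /N1 -natr1.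
have NN : (0 : R) <= N%:R by [].
pose z := x + (y - x) / N1.
have d1 : `|x - z| <= t.
  have -> : x - z = (x - y) / N1 by rewrite /z; ring.
  by rewrite normrM normfV (gtr0_norm N0) ler_pdivrMr // mulrC.
have d2 : `|z - y| <= N%:R * t.
  have -> : z - y = N%:R * ((x - y) / N1).
    rewrite /z NE; field; lra.
  rewrite normrM ger0_norm // ler_wpM2l //.
  by rewrite normrM normfV (gtr0_norm N0) ler_pdivrMr // mulrC.
have z01 : 0 <= z <= 1.
  have i0 : 0 <= N1^-1 <= 1 by rewrite invr_ge0 ltW //= invf_le1 // ler1n.
  rewrite /z; move: (N1^-1) i0 x01 y01 => i.
  move=> /andP[i0 i1] /andP[x0 x1] /andP[y0 y1].
  have -> : x + (y - x) * i = (1 - i) * x + i * y by ring.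
  have a0 : 0 <= (1 - i) * x by rewrite mulr_ge0 // subr_ge0.
  have a1 : (1 - i) * x <= 1 - i by rewrite ler_piMr // subr_ge0.
  have b0 : 0 <= i * y by rewrite mulr_ge0.
  have b1 : i * y <= i by rewrite ler_piMr.
  by apply/andP; split; lra.
have -> : f x - f y = (f x - f z) + (f z - f y) by ring.
rewrite (le_trans (ler_normD _ _)) // NE mulrDl mul1r addrC lerD ?IH //.
exact: le_modulus.
Qed.

(** With r = (x - y) / t and |r| > 1, a chain of floor |r| + 1 pieces suffices, and floor |r| <= |r|
    <= r^2. The quadratic form can be averaged by a second moment. *)
Lemma le_modulus_sqr f (t : R) x y : {within `[0, 1], continuous f} -> 0 < t ->
  0 <= x <= 1 -> 0 <= y <= 1 ->
  `|f x - f y| <= (1 + ((x - y) / t) ^+ 2) * modulus f t.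
Proof.
move=> cf t0 x01 y01.
have w0 : 0 <= modulus f t.
  by apply: le_trans (le_modulus cf x01 x01 _); rewrite // subrr normr0 ltW.
set r := (x - y) / t.
have [h|h] := leP `|x - y| t.
  rewrite (le_trans (le_modulus cf x01 y01 h)) // ler_peMl // lerDl.
  exact: sqr_ge0.
have r1 : 1 < `|r| by rewrite /r normrM normfV (gtr0_norm t0) ltr_pdivlMr // mul1r.
have /andP[h1 h2] := truncn_itv (normr_ge0 r).
apply: (@le_trans _ _ ((Num.truncn `|r|).+1%:R * modulus f t)).
  apply: modulus_chain => //; first exact: ltW.
  rewrite -ler_pdivrMr // (le_trans _ (ltW h2)) // /r normrM normfV.
  by rewrite (gtr0_norm t0).
rewrite ler_wpM2r // -natr1 addrC lerD2l (le_trans h1) //.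
rewrite -[in leRHS]real_normK ?num_real //; nra.
Qed.

End Calculus01.

(** * The quantitative Voronovskaya estimate for 0 < q < 1 *)

Section Voronovskaya.
Context {R : realType}.
Implicit Types (q u x : R) (f : R -> R) (n m k j N : nat).

(** Taken at 1/q and at the odds of 1 - x, this becomes v(q, x) (1 - x). *)
Let w q u : R := u / ((1 + u) * (1 + q * u)).

(** Its decrement from m to m+1 is q^m / ([m] [m+1]), the factor of [lupas_odds_diff] that depends
    on m apart from the product; its inverse is the normalisation of the theorem. *)
Let al q n : R := q ^+ n / qint q n.

(** The error is an average of deviations of f'' / 2 from its value at x, under weights with odds
    q^2 u, controlled by [qsum_deviation]. The scale n is kept apart from N so that one modulus
    serves all steps. *)
Lemma lupas_odds_step q u f n N : 0 < q < 1 -> 0 <= u -> C2_01 f ->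
  (0 < n)%N -> (n <= N.+1)%N ->
  `|lupas_odds q u N.+1 f - lupas_odds q u N.+2 f
    - w q u * (deriv01 (deriv01 f) (u / (1 + u)) / 2) * (al q N.+1 - al q N.+2)|
  <= 12 * w q u * modulus (deriv01 (deriv01 f)) (Num.sqrt (qint q n))^-1
     * (al q N.+1 - al q N.+2).
Proof.
move=> q01 u0 Cf n0 nN; set G := deriv01 _; set d := al _ _ - al _ _.
have /andP[qgt0 q1] := q01; have q0 := ltW qgt0.
have cG : {within `[0, 1], continuous G} by case: Cf.
set om := modulus _ _; set x := u / (1 + u).
have u1 : 0 < 1 + u by rewrite (lt_le_trans ltr01) ?lerDl.
have x01 : 0 <= x <= 1.
  by rewrite /x divr_ge0 ?(ltW u1) // ler_pdivrMr // mul1r lerDr ler01.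
have m0 := qintS_gt0 N q0; have m10 := qintS_gt0 N.+1 q0.
have v0 : 0 <= q ^+ 2 * u by rewrite mulr_ge0 ?exprn_ge0.
have qu1 : 0 < 1 + q * u by rewrite (lt_le_trans ltr01) ?lerDl ?mulr_ge0.
set D := qprod q (q ^+ 2 * u) N.
have D0 : 0 < D by rewrite (lt_le_trans ltr01) ?qprod_ge1.
have ng0 : 0 < qint q n by case: (n) n0 => // k _; exact: qintS_gt0.
have nm : qint q n <= qint q N.+1 by rewrite ler_qint.
have m1 := qintS_ge1 N q0.
set t := (Num.sqrt (qint q n))^-1.
have t0 : 0 < t by rewrite invr_gt0 sqrtr_gt0.
have tE : t ^- 2 = qint q n by rewrite /t exprVn invrK sqr_sqrtr // ltW.
have om0 : 0 <= om.
  by apply: le_trans (le_modulus cG x01 x01 _); rewrite // subrr normr0 ltW.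
rewrite lupas_odds_diff //; set dd := fun j => divdiff2 _ _ _ _.
(* The first two factors go into [w]; the rest, [D], normalises the weights with odds q^2 u. *)
have -> : qprod q u N.+2 = (1 + u) * (1 + q * u) * D.
  by rewrite /D !qprodSl mulrA expr2 [q * (q * u)]mulrA.
have dE : d = q ^+ N.+1 / (qint q N.+1 * qint q N.+2).
  rewrite /d /al [q ^+ N.+2]exprS; move: m10; rewrite [qint q N.+2]qintS => m10.
  by field; rewrite !gt_eqF.
have d0 : 0 <= d by rewrite dE divr_ge0 ?exprn_ge0 // mulr_ge0 // ltW.
have w0 : 0 <= w q u by rewrite divr_ge0 // mulr_ge0 // ltW.
have -> : q ^+ N.+1 * u / (qint q N.+1 * qint q N.+2 * ((1 + u) * (1 + q * u) * D)) =
    w q u * d / D.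
  by rewrite dE /w; field; rewrite !gt_eqF.
set Gx := G x / 2.
have pointwise j : (j <= N)%N -> `|dd j - Gx| <=
    om / 2 + om / qint q N.+1 * (qint q j - qint q N.+1 * x) ^+ 2 + om / qint q N.+1.
  move=> jN.
  have j0 : 0 <= qint q j by rewrite qint_ge0.
  have P0 : 0 < q ^+ j by rewrite exprn_gt0.
  have P1 : q ^+ j <= 1 by rewrite exprn_ile1 // ltW.
  have [xi /andP[bxi xia] ddE] : exists2 xi,
      qint q j / qint q N.+1 <= xi <= qint q j.+1 / qint q N.+1 &
      dd j = G xi / 2.
    apply: divdiff2_mean => //.
    - by rewrite divr_ge0 // ltW.
    (* After cross-multiplication the gap is [j+1] [N+1] - [j] [N+2] = q^j [N+1-j]. *)
    - rewrite ltr_pdivrMr // mulrAC ltr_pdivlMr //.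
      have -> : qint q N.+1 = qint q (N.+1 - j) + q ^+ (N.+1 - j) * qint q j.
        by rewrite -qintD subnK // leqW.
      have -> : qint q N.+2 = qint q (N.+1 - j) + q ^+ (N.+1 - j) * qint q j.+1.
        by rewrite -qintD addnS subnK // leqW.
      rewrite qintSr -subr_gt0.
      have s0 : 0 < qint q (N.+1 - j) by rewrite subSn // qintS_gt0.
      rewrite [ltRHS](_ : _ = q ^+ j * qint q (N.+1 - j)); first exact: mulr_gt0.
      by ring.
    - rewrite ltr_pM2l ?qintS_gt0 // ltf_pV2 ?posrE // [ltRHS]qintSr ltrDl.
      by rewrite exprn_gt0.
    - by have /andP[] := @qint_ratio01 _ q j.+1 N.+1 q0 jN.
  have xi01 : 0 <= xi <= 1.
    have /andP[_ h1] := @qint_ratio01 _ q j.+1 N.+1 q0 jN.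
    by rewrite (le_trans xia h1) andbT (le_trans _ bxi) // divr_ge0 // ltW.
  have -> : dd j - Gx = (G xi - G x) / 2 by rewrite ddE /Gx; ring.
  rewrite normrM [`|2^-1|]ger0_norm ?invr_ge0 //.
  have := le_modulus_sqr cG t0 xi01 x01.
  rewrite -/om expr_div_n tE => h.
  (* The outer nodes are q^j / [N+1] apart, so [xi] lies within 1 / [N+1] of [j] / [N+1]; the square
     of a sum is at most twice the sum of squares. *)
  have key : (xi - x) ^+ 2 * qint q n <=
      2 / qint q N.+1 * ((qint q j - qint q N.+1 * x) ^+ 2 + 1).
    apply: (@le_trans _ _ ((xi - x) ^+ 2 * qint q N.+1)).
      by rewrite ler_wpM2l ?sqr_ge0.
    rewrite [leRHS](_ : _ = 2 * ((qint q j / qint q N.+1 - x) ^+ 2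
      + (qint q N.+1)^-1 ^+ 2) * qint q N.+1); last by field; rewrite gt_eqF.
    rewrite ler_pM2r //.
    have r0 : 0 <= xi - qint q j / qint q N.+1 by rewrite subr_ge0.
    have r1 : xi - qint q j / qint q N.+1 <= (qint q N.+1)^-1.
      rewrite lerBlDr (le_trans xia) // qintSr mulrDl addrC lerD2r.
      by rewrite ler_piMl // invr_ge0 ltW.
    have r2 : (xi - qint q j / qint q N.+1) ^+ 2 <= (qint q N.+1)^-1 ^+ 2.
      by rewrite ler_sqr ?nnegrE // invr_ge0 ltW.
    move: r0 r1 r2; move: (qint q j / qint q N.+1) => b.
    move: (qint q N.+1)^-1 => i r0 r1 r2.
    have -> : (xi - x) ^+ 2 =
      2 * ((b - x) ^+ 2 + (xi - b) ^+ 2) - ((b - x) - (xi - b)) ^+ 2 by ring.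
    by have := sqr_ge0 ((b - x) - (xi - b)); lra.
  rewrite ler_pdivrMr // (le_trans h) //.
  apply: (@le_trans _ _ ((1 + 2 / qint q N.+1 *
    ((qint q j - qint q N.+1 * x) ^+ 2 + 1)) * om)).
    by rewrite ler_wpM2r // lerD2l.
  by rewrite le_eqVlt; apply/orP; left; apply/eqP; field; rewrite gt_eqF.
(* The constants add up to 1/2 + 1 + 10 <= 12, with 10 from [qsum_deviation] and [N+1] >= 1. *)
have sumB : `|qsum q (q ^+ 2 * u) N dd - Gx * D| <= 12 * om * D.
  rewrite /D -(qsum1 _ _ q0) -qsumZ -sumrB.
  apply: (@le_trans _ _ (qsum q (q ^+ 2 * u) N (fun j => `|dd j - Gx|))).
    rewrite (le_trans (ler_norm_sum _ _ _)) // ler_sum // => i _.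
    by rewrite mulr1 -mulrBr normrM ger0_norm ?qterm_ge0.
  apply: le_trans (ler_qsum q0 v0 pointwise) _.
  rewrite (@eq_qsum _ _ _ _ _ (fun j => (om / 2 + om / qint q N.+1) * 1 +
    om / qint q N.+1 * (qint q j - qint q N.+1 * x) ^+ 2)) => [|k _]; last by ring.
  rewrite qsumD !qsumZ qsum1 //.
  have dev := @qsum_deviation _ q u N q01 u0; rewrite -/x -/D in dev *.
  have oi0 : 0 <= om / qint q N.+1 by rewrite divr_ge0 // ltW.
  have := ler_wpM2l oi0 dev.
  have -> : om / qint q N.+1 * (10 * qint q N.+1 * D) = 10 * om * D.
    by field; rewrite gt_eqF.
  have : om / qint q N.+1 <= om by rewrite ler_pdivrMr // ler_peMr.
  move=> h1 h2.
  have h3 : (om / 2 + om / qint q N.+1) * D <= (om / 2 + om) * D.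
    by rewrite ler_wpM2r ?(ltW D0) // lerD2l.
  have : 0 <= om * D by rewrite mulr_ge0 // ltW.
  by move: h2 h3; set E := qsum _ _ _ _; lra.
have -> : w q u * d / D * qsum q (q ^+ 2 * u) N dd - w q u * Gx * d =
    w q u * d / D * (qsum q (q ^+ 2 * u) N dd - Gx * D).
  by field; rewrite gt_eqF.
have c0 : 0 <= w q u * d / D by apply: divr_ge0 (ltW D0); apply: mulr_ge0.
rewrite normrM (ger0_norm c0) (le_trans (ler_wpM2l c0 sumB)) //.
by rewrite le_eqVlt; apply/orP; left; apply/eqP; field; rewrite gt_eqF.
Qed.

(** Main term and error bound are multiples of the same decrements of [al], so adding the steps
    telescopes both. *)
Lemma lupas_odds_telescope q u f n k : 0 < q < 1 -> 0 <= u -> C2_01 f ->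
  (0 < n)%N ->
  `|lupas_odds q u n f - lupas_odds q u (k + n) f
    - w q u * (deriv01 (deriv01 f) (u / (1 + u)) / 2) * (al q n - al q (k + n))|
  <= 12 * w q u * modulus (deriv01 (deriv01 f)) (Num.sqrt (qint q n))^-1
     * (al q n - al q (k + n)).
Proof.
move=> q01 u0 Cf n0; elim: k => [|k IH].
  by rewrite add0n !subrr !mulr0 subr0 normr0.
have := @lupas_odds_step q u f n (k + n).-1 q01 u0 Cf n0.
rewrite prednK; last by rewrite addn_gt0 n0 orbT.
move=> /(_ (leq_addl _ _)) st; move: IH st; rewrite addSn.
move: (w q u * (_ / 2)) (12 * _ * _) => c K IH st.
have -> : al q n - al q (k + n).+1 =
  (al q n - al q (k + n)) + (al q (k + n) - al q (k + n).+1) by ring.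
rewrite [leRHS]mulrDr; apply: le_trans (lerD IH st).
rewrite (le_trans _ (ler_normD _ _)) // le_eqVlt; apply/orP; left; apply/eqP.
by congr `|_|; ring.
Qed.

Lemma cvg_within01 f (s : nat -> R) (l : R) : {within `[0, 1], continuous f} ->
  0 <= l <= 1 -> (\forall n \near \oo, 0 <= s n <= 1) -> s n @[n --> \oo] --> l ->
  f (s n) @[n --> \oo] --> f l.
Proof.
move=> /subspace_continuousP cf l01 s01 sl.
have lI : `[0, 1]%classic l by rewrite /= in_itv.
have /cvgrPdist_le H := cf l lI.
apply/cvgrPdist_le => e e0; have [d /= d0 Hd] := H e e0.
move/cvgrPdist_lt : sl => /(_ d d0) sl.
near=> n; apply: Hd; first by near: n.
by rewrite /= in_itv /=; near: n.
Unshelve. all: by end_near. Qed.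

(** Let k tend to infinity in the telescoped estimate, where [al] tends to 0, and divide by
    [al q n]. *)
Lemma lupas_odds_voronovskaya q u f n L : 0 < q < 1 -> 0 <= u -> C2_01 f ->
  (0 < n)%N -> lupas_odds q u m f @[m --> \oo] --> L ->
  `|qint q n / q ^+ n * (lupas_odds q u n f - L)
    - deriv01 (deriv01 f) (u / (1 + u)) / 2 * w q u|
  <= 12 * w q u * modulus (deriv01 (deriv01 f)) (Num.sqrt (qint q n))^-1.
Proof.
move=> q01 u0 Cf n0 cL; set G := deriv01 _; have /andP[qgt0 q1] := q01; have q0 := ltW qgt0.
have cG : {within `[0, 1], continuous G} by case: Cf.
set om := modulus _ _; set x := u / (1 + u).
have u1 : 0 < 1 + u by rewrite (lt_le_trans ltr01) ?lerDl.
have x01 : 0 <= x <= 1.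
  by rewrite /x divr_ge0 ?(ltW u1) // ler_pdivrMr // mul1r lerDr ler01.
have qu1 : 0 < 1 + q * u by rewrite (lt_le_trans ltr01) ?lerDl ?mulr_ge0.
have w0 : 0 <= w q u by rewrite divr_ge0 // mulr_ge0 // ltW.
have ng0 : 0 < qint q n by case: (n) n0 => // k _; exact: qintS_gt0.
have om0 : 0 <= om.
  apply: le_trans (le_modulus cG x01 x01 _); rewrite // subrr normr0.
  by rewrite invr_ge0 sqrtr_ge0.
have cal : al q m @[m --> \oo] --> (0 : R).
  rewrite -(mul0r (1 - q)^-1^-1); apply: cvgM.
    by apply: cvg_expr; rewrite gtr0_norm.
  apply: cvgV; last exact: cvg_qint.
  by rewrite invr_neq0 // subr_eq0 gt_eqF.
have al0 m : 0 <= al q m by rewrite divr_ge0 ?exprn_ge0 ?qint_ge0.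
have cLn : lupas_odds q u (k + n) f @[k --> \oo] --> L.
  by have := cL; rewrite -(@cvg_shiftn n _ (fun m => lupas_odds q u m f)).
have caln : al q (k + n) @[k --> \oo] --> (0 : R).
  by have := cal; rewrite -(@cvg_shiftn n _ (al q)).
have bound : `|lupas_odds q u n f - L - w q u * (G x / 2) * (al q n - 0)| <=
    12 * w q u * om * al q n.
  have cN : `|lupas_odds q u n f - lupas_odds q u (k + n) f -
      w q u * (G x / 2) * (al q n - al q (k + n))| @[k --> \oo] -->
    `|lupas_odds q u n f - L - w q u * (G x / 2) * (al q n - 0)|.
    apply: cvg_norm; apply: cvgB; first by apply: cvgB => //; exact: cvg_cst.
    by apply: cvgMl_tmp; apply: cvgB => //; exact: cvg_cst.
  apply: (cvgr_to_le cN); apply: nearW => k.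
  have := @lupas_odds_telescope q u f n k q01 u0 Cf n0.
  move=> h; apply: le_trans h _.
  apply: ler_wpM2l; last by rewrite lerBlDr lerDl.
  by apply: mulr_ge0 => //; apply: mulr_ge0.
rewrite subr0 in bound.
have an0 : 0 < al q n by rewrite divr_gt0 ?exprn_gt0.
have -> : qint q n / q ^+ n * (lupas_odds q u n f - L) - G x / 2 * w q u =
    (lupas_odds q u n f - L - w q u * (G x / 2) * al q n) / al q n.
  by rewrite /al; field; rewrite !gt_eqF // exprn_gt0.
by rewrite normrM normfV (gtr0_norm an0) ler_pdivrMr.
Qed.

End Voronovskaya.

(** * The symmetry between q and 1/q, and the case q > 1 *)

Section Reflection.
Context {R : realType}.
Implicit Types (q x : R) (f : R -> R) (n k : nat).

Lemma qintV q n : q != 0 -> qint q n.+1 = q ^+ n * qint q^-1 n.+1.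
Proof.
move=> q0; elim: n => [|n IH]; first by rewrite !qint1 expr0 mulr1.
rewrite qintSr IH [in RHS]qintS exprS; field.
exact: q0.
Qed.

Lemma qfactV q n : q != 0 -> qfact q n = q ^+ 'C(n, 2) * qfact q^-1 n.
Proof.
move=> q0; elim: n => [|n IH]; first by rewrite !qfact0 expr0 mulr1.
by rewrite !qfactS IH qintV // binS bin1 exprD; ring.
Qed.

(** With p = 1/q, the splitting [n] = [n-k] + p^(n-k) [k] at p makes the left side p^(n-k) [k] /
    [n], and [qintV] absorbs the power. *)
Lemma qint_ratio_reflect q n k : 0 < q -> (0 < n)%N -> (k <= n)%N ->
  1 - qint q^-1 (n - k) / qint q^-1 n = qint q k / qint q n.
Proof.
move=> qgt0; have q0 : q != 0 by rewrite gt_eqF.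
have p0 : 0 <= q^-1 by rewrite invr_ge0 ltW.
case: n k => [//|n] [|k] _ kn.
  by rewrite subn0 divff ?subrr ?qint0 ?mul0r // gt_eqF ?qintS_gt0.
have nE : q ^+ n = q ^+ (n - k) * q ^+ k by rewrite -exprD subnK.
have n0 : qint q^-1 n.+1 != 0 by rewrite gt_eqF ?qintS_gt0.
have iE : qint q^-1 n.+1 = qint q^-1 (n - k) + q^-1 ^+ (n - k) * qint q^-1 k.+1.
  by rewrite -qintD addnS subnK.
rewrite (qintV n q0) (qintV k q0) subSS nE; move: n0; rewrite iE exprVn.
have : q ^+ (n - k) != 0 by rewrite expf_neq0.
have : q ^+ k != 0 by rewrite expf_neq0.
move: (q ^+ k) (q ^+ (n - k)) (qint _ k.+1) (qint _ (n - k)) => Q P S T Q0 P0 n0.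
have TPS : T * P + S != 0.
  have -> : T * P + S = P * (T + P^-1 * S) by field.
  by rewrite mulf_neq0.
by field; rewrite P0 TPS Q0.
Qed.

(** Factor by factor, x + q^(-j) (1 - x) = q^(-j) (1 - x + q^j x), and the exponents add up to C(n,
    2). *)
Lemma prod_lupas_reflect q x n : q != 0 ->
  \prod_(1 <= j < n) (1 - (1 - x) + q^-1 ^+ j * (1 - x)) =
  q^-1 ^+ 'C(n, 2) * \prod_(1 <= j < n) (1 - x + q ^+ j * x).
Proof.
move=> q0; case: n => [|n]; first by rewrite !big_geq // expr0 mulr1.
elim: n => [|n IH]; first by rewrite !big_geq // expr0 mulr1.
rewrite big_nat_recr // [in RHS]big_nat_recr // IH [in RHS]binS bin1 exprD /= !exprVn.
by field; rewrite !expf_neq0.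
Qed.

(** The terms match under k -> n - k: nodes are mirrored, and the powers of q from the Gaussian
    binomial, the weight and the product cancel. *)
Lemma lupas_reflect q n f x : 0 < q -> (0 < n)%N ->
  lupas q n f x = lupas q^-1 n (fun y => f (1 - y)) (1 - x).
Proof.
move=> qgt0 n0; have q0 : q != 0 by rewrite gt_eqF.
rewrite /lupas [RHS](reindex_inj rev_ord_inj) /=.
apply: eq_bigr => -[k /=]; rewrite ltnS => kn _.
rewrite subSS qint_ratio_reflect // prod_lupas_reflect // subKn //; congr (_ * _).
have -> : 1 - (1 - x) = x by ring.
rewrite -!bin2 /qbinom subKn // (qfactV n) // (qfactV k) // (qfactV (n - k)) //.
rewrite !invfM !exprVn.
have Ek : q ^+ 'C(k, 2) != 0 by rewrite expf_neq0.
have En : q ^+ 'C(n, 2) != 0 by rewrite expf_neq0.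
have Enk : q ^+ 'C(n - k, 2) != 0 by rewrite expf_neq0.
move: (q ^+ 'C(k, 2)) (q ^+ 'C(n, 2)) (q ^+ 'C(n - k, 2)) Ek En Enk.
move: (\prod_(_ <= _ < _) _)^-1 (qfact _ k)^-1 (qfact _ (n - k))^-1 (qfact _ n).
move=> D F1 F2 F3 A B C A0 B0 C0.
by field; rewrite A0 B0 C0.
Qed.

(** At x = 0 the reflected point 1 has infinite odds, so this endpoint is evaluated directly. *)
Lemma lupas0 q n f : 0 < q -> (0 < n)%N -> lupas q n f 0 = f 0.
Proof.
move=> q0 n0; rewrite /lupas big_ord_recl [X in _ + X]big1 => [|i _]; last first.
  by rewrite lift0 exprS !(mulr0, mul0r).
rewrite addr0 /= qint0 mul0r gaussE // gauss0 ?ltW // subr0 !expr0 expr1n !mul1r.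
by rewrite big1 ?invr1 ?mulr1 // => j _; rewrite mulr0 addr0.
Qed.

End Reflection.

Theorem corollary20 (R : realType) :
  exists2 K : R, 0 < K &
    forall (q : R) (f : R -> R) (n : nat) (x : R),
      1 < q -> C2_01 f -> (1 <= n)%N -> x \in `[0, 1] ->
      let g := fun y : R => f (1 - y) in
      `|q ^+ n * qint q^-1 n * (lupas q n f x - lupas_lim q f x)
        - deriv01 (deriv01 f) x / 2 * lupas_v q x * (1 - x)|
      <= K * lupas_v q x * (1 - x)
         * modulus (deriv01 (deriv01 g)) (Num.sqrt (qint q^-1 n))^-1.
Proof.
exists 12 => // q f n x q1 Cf n0; rewrite in_itv /= => /andP[x0 x1].
set g := fun y : R => f (1 - y).
have qgt0 : 0 < q by rewrite (lt_trans ltr01).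
rewrite /lupas_lim ltNge (ltW q1) /= -/g.
have [->|xn0] := eqVneq x 0.
  rewrite lupas0 // /lupas_lim_lt1 subr0 eqxx /g subrr /lupas_v.
  by rewrite !(subrr, mulr0, mul0r, subr0, normr0).
have xgt0 : 0 < x by rewrite lt_neqAle eq_sym xn0.
have p01 : 0 < q^-1 < 1 by rewrite invr_gt0 qgt0 invf_lt1.
have Cg : C2_01 g by exact: C2_01_reflect.
have y1 : 1 - x != 1 by rewrite -subr_eq0 addrAC subrr add0r oppr_eq0.
(* The odds of the reflected point 1 - x, finite because x > 0. *)
pose u := (1 - x) / (1 - (1 - x)).
have u0 : 0 <= u by rewrite divr_ge0 ?subKr ?subr_ge0.
have cg : {within `[0, 1], continuous g} by apply: derivable01_continuous; case: Cg.
have [C _ gC] := within01_bounded cg.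
have /andP[p0 p1] := p01.
have := @lupas_odds_cvg _ q^-1 u g C p01 u0 gC.
set L := limn _ => cL.
have {}cL : lupas_odds q^-1 u m g @[m --> \oo] --> L.
  apply: cL => k; apply: cvg_within01 => //.
  - rewrite subr_ge0 exprn_ile1 ?(ltW p0) ?(ltW p1) //=.
    by rewrite lerBlDr lerDl exprn_ge0 // ltW.
  - exists k => // m /= km; apply: qint_ratio01 => //; exact: ltW.
  - rewrite -qint_mul1B mulrC -[1 - q^-1]invrK; apply: cvgMl_tmp.
    apply: cvgV; last exact: cvg_qint.
    by rewrite invr_neq0 // subr_eq0 gt_eqF.
have -> : lupas_lim_lt1 q^-1 g (1 - x) = L by rewrite /lupas_lim_lt1 (negPf y1).
rewrite lupas_reflect // -/g lupasE // -/u.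
have := lupas_odds_voronovskaya p01 u0 Cg n0 cL.
have -> : u / (1 + u) = 1 - x.
  rewrite /u subKr; field.
  by rewrite xn0 addrC subrK oner_neq0.
have den' : 1 - x + q * x != 0.
  by rewrite gt_eqF // ltr_wpDl ?subr_ge0 // mulr_gt0.
have -> : u / ((1 + u) * (1 + q^-1 * u)) = lupas_v q x * (1 - x).
  rewrite /u /lupas_v subKr; field.
  by rewrite den' xn0 (gt_eqF qgt0) addrC subrK oner_neq0.
have y01 : 0 <= 1 - x <= 1 by rewrite subr_ge0 x1 lerBlDr lerDl.
(* Reflecting twice gives g''(1 - x) = f''(x), and dividing by (1/q)^n is multiplying by q^n. *)
by rewrite /g (deriv2_01_reflect Cf y01).2 subKr exprVn invrK [qint _ n * _]mulrC !mulrA.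
Qed.
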